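(* Let $\Gamma$ be a connected ve-srg with parameters $(n,k,\lambda,\mu)$, let $G\le \mathrm{Aut}(\Gamma)$ be transitive on the vertices and on the edges of $\Gamma$, and let $1\neq N\triangleleft G$ be intransitive on $V(\Gamma)$. Suppose the quotient graph satisfies $\Gamma_N\cong K_{m+1}$ for some $m\ge 1$. Let $b$ be the number of vertices in each $N$-orbit, and let $\ell=k/m$, which is the number of edges from $x$ to vertices of ${}^Ny$ whenever ${}^Nx$ and ${}^Ny$ are adjacent in $\Gamma_N$. Then (1) $(b-1)\mu=\ell m(\ell-1)$, and in particular $\ell\ge 2$; (2) $(b-\ell)\mu=\ell(\ell m-\ell-\lambda)$; (3) $\mu(\ell-1)=\ell(\ell+\lambda-m)$; (4) $\ell\mid\mu$. Furthermore, if $\Gamma$ is not the complete multipartite graph $K_{(m+1)[b]}$, then (5) $\mu\le (m-1)\ell$.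
   Context: A strongly regular graph with parameters $(n,k,\lambda,\mu)$ is a (finite, simple) regular graph with $n$ vertices and valency $k$, such that each pair of adjacent vertices lies in exactly $\lambda$ triangles and each pair of distinct non-adjacent vertices (if such exist) is joined by exactly $\mu$ paths of length 2. The complete graph $K_n$ is regarded as strongly regular with parameters $(n,n-1,n-2,0)$. A ve-srg is a strongly regular graph whose automorphism group is transitive on vertices and transitive on (undirected) edges. Quotient graph: if $G\le\mathrm{Aut}(\Gamma)$ is vertex-transitive and $1\neq N\triangleleft G$ is intransitive on $V(\Gamma)$, then $\Gamma_N$ is the graph whose vertices are the orbits ${}^Nx=\{h(x): h\in N\}$ of $N$ on $V(\Gamma)$, two distinct orbits ${}^Nx,{}^Ny$ being adjacent if and only if some $x'\in{}^Nx$ and some $y'\in{}^Ny$ are adjacent in $\Gamma$. $K_{c[b]}$ denotes the complete $c$-partite graph with $b$ vertices in each part. *)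

(* Defs.v *)
(* Finite graphs as relations on a finType, in the MathComp library. *)
From mathcomp Require Import all_boot all_order all_algebra all_fingroup.

Set Implicit Arguments.
Unset Strict Implicit.
Unset Printing Implicit Defensive.

Definition simple_graph (T : finType) (e : rel T) : Prop :=
  symmetric e /\ irreflexive e.

Definition connected_graph (T : finType) (e : rel T) : Prop :=
  forall x y : T, connect e x y.

Definition graph_iso (T1 T2 : finType) (e1 : rel T1) (e2 : rel T2) : Prop :=
  exists2 f : T1 -> T2, bijective f & forall x y, e2 (f x) (f y) = e1 x y.

Definition complete_graph (n : nat) : rel 'I_n := fun i j => i != j.

(* K_{c[b]}: the vertex (i, j) is the j-th vertex of part i. *)
Definition complete_multipartite (c b : nat) : rel ('I_c * 'I_b) :=
  fun u v => u.1 != v.1.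

Definition neighbours (T : finType) (e : rel T) (x : T) : {set T} :=
  [set y | e x y].

Definition edges (T : finType) (e : rel T) : {set {set T}} :=
  [set [set p.1; p.2] | p : T * T & e p.1 p.2].

Definition graph_aut (T : finType) (e : rel T) : {set {perm T}} :=
  [set g : {perm T} | [forall x, forall y, e (g x) (g y) == e x y]].

Lemma graph_aut_group_set (T : finType) (e : rel T) : group_set (graph_aut e).
Proof.
apply/group_setP; split=> [|g h].
  by rewrite inE; apply/'forall_forallP=> x y; rewrite !perm1.
rewrite !inE => /'forall_'forall_eqP ge /'forall_'forall_eqP he.
by apply/'forall_'forall_eqP => x y; rewrite !permM he ge.
Qed.

Canonical graph_aut_group (T : finType) (e : rel T) : {group {perm T}} :=
  Group (graph_aut_group_set e).

Definition vertex_transitive (T : finType) (A : {set {perm T}}) : Prop :=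
  [transitive A, on [set: T] | 'P].

(* [transitive _, on S | _] forces S to be nonempty, hence the guard: any group
   is transitive on the edges of an edgeless graph. *)
Definition edge_transitive (T : finType) (e : rel T) (A : {set {perm T}}) :
    Prop :=
  edges e != set0 -> [transitive A, on edges e | 'P^*].

(* A triangle on the edge xy, or a path of length 2 from x to y, is given by a
   common neighbour of x and y. The last clause fixes the parameters of K_n,
   where mu (and, for n = 1, lambda) is not determined by the counts; the nat
   subtraction makes lambda = 0 for K_1. *)
Definition strongly_regular (T : finType) (e : rel T)
    (n k lambda mu : nat) : Prop :=
  [/\ simple_graph e,
      #|T| = n /\ (forall x, #|neighbours e x| = k),
      forall x y, e x y -> #|neighbours e x :&: neighbours e y| = lambda,
      forall x y, x != y -> ~~ e x y ->
        #|neighbours e x :&: neighbours e y| = mu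
    & (forall x y, x != y -> e x y) -> lambda = n - 2 /\ mu = 0].

Definition ve_srg (T : finType) (e : rel T) (n k lambda mu : nat) : Prop :=
  [/\ strongly_regular e n k lambda mu,
      vertex_transitive (graph_aut e)
    & edge_transitive e (graph_aut e)].

Definition orbits (T : finType) (N : {group {perm T}}) : {set {set T}} :=
  [set orbit 'P N x | x : T].

Definition block_adj (T : finType) (e : rel T) : rel {set T} :=
  fun X Y => (X != Y) && [exists x in X, exists y in Y, e x y].

Definition quotient_graph (T : finType) (e : rel T) (N : {group {perm T}}) :
    rel {X : {set T} | X \in orbits N} :=
  fun X Y => block_adj e (val X) (val Y).

(* Main.v *)
Require Import Defs.
From mathcomp Require Import all_boot all_order all_algebra all_fingroup.
From mathcomp Require Import zify ring.

Set Implicit Arguments.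
Unset Strict Implicit.
Unset Printing Implicit Defensive.

Import Order.TTheory GRing.Theory Num.Theory.

(** Call the N-orbits blocks; normality of N makes them a system of imprimitivity
    for G. No block contains an edge: otherwise, by edge-transitivity, every edge
    would lie in a block, and connectedness would leave a single block, against
    the intransitivity of N. Let x lie in X and y in Y, where X and Y are blocks.
    The number of neighbours of x in Y depends on X and Y only, since N is
    transitive on X, and it is symmetric in X and Y, since all blocks have the
    same size b. As G permutes the edges transitively, it is one number l for
    all adjacent pairs of blocks ([block_deg_adj]), that is, for all pairs of
    distinct blocks, the quotient being complete.

    So the blocks are the classes of an equitable colouring: m + 1 colours,
    classes of size b, and every vertex has l neighbours of each other colour and
    none of its own. The rest is counting. Fix a vertex x and count the paths of
    length 2 from x to a colour class in two ways, by their ends, which gives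
    lambda and mu, and by their midpoints, which gives l and m
    ([equitable_two_paths]). For the class of x this is
      l m + (b - 1) mu = l (l m),
    where the term l m counts the closed paths; for another class it is
      l lambda + (b - l) mu = l (l m - l).
    These are the first two identities, and their difference is the third, by
    which l divides (l - 1) mu = l mu - mu, hence mu. If l were 1, then the first
    would give mu = 0 since b > 1, but a connected strongly regular graph that is
    not complete has mu > 0 ([mu_gt0]).

    Finally, if the graph is not complete multipartite on the classes, then some
    x and y of different colours are not adjacent. Their common neighbours are
    neighbours of x that do not have the colour of y, and there are l m - l of
    those ([equitable_mu_le]), which is the bound on mu. *)

(** * Counting in graphs *)

(** Both sides count the edges from A to B. With B the neighbourhood of a vertex
    v, the left side counts the paths of length 2 from v to A. *)
Lemma sum_neighbours_setI (T : finType) (e : rel T) (A B : {set T}) :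
  symmetric e ->
  \sum_(x in A) #|neighbours e x :&: B| = \sum_(y in B) #|neighbours e y :&: A|.
Proof.
move=> e_sym.
have deg_sum X x : #|neighbours e x :&: X| = \sum_(y in X) e x y.
  rewrite -sum1_card big_mkcond [RHS]big_mkcond /=; apply: eq_bigr => y _.
  by rewrite !inE; case: (e x y); case: (y \in X).
under eq_bigr do rewrite deg_sum; under [RHS]eq_bigr do rewrite deg_sum.
by rewrite exchange_big /=; under eq_bigr do under eq_bigr do rewrite e_sym.
Qed.

(** The relation generated by the edges of a connected graph is total; used to
    spread a property of the edges to all pairs of vertices. *)
Lemma connected_rel_total (T : finType) (e r : rel T) :
  connected_graph e -> reflexive r -> transitive r -> subrel e r ->
  forall x y, r x y.
Proof.
move=> e_conn r_refl r_trans e_r x y; have /connectP[s] := e_conn x y.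
elim: s x => [|z s IHs] x /= => [_ -> //|/andP[/e_r xz] zs y_last].
exact: r_trans xz (IHs z zs y_last).
Qed.

(** If mu = 0, then two distinct vertices with a common neighbour are adjacent, so
    being equal or adjacent is transitive and a connected graph is complete. *)
Lemma mu_gt0 (T : finType) (e : rel T) n k lambda mu :
  strongly_regular e n k lambda mu -> connected_graph e ->
  (exists x y, x != y /\ ~~ e x y) -> 0 < mu.
Proof.
move=> [[e_sym _] _ _ e_mu _] e_conn [x [y [xy /negP exy]]].
rewrite lt0n; apply/eqP => mu0; apply: exy.
suff: (x == y) || e x y by rewrite (negPf xy).
apply: (@connected_rel_total T e [rel u v | (u == v) || e u v]) => //.
- by move=> u /=; rewrite eqxx.
- move=> v u w /= /orP[/eqP-> //|uv] /orP[/eqP<-|vw]; first by rewrite uv orbT.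
  case: eqP => //= /eqP uw; apply/idPn => euw.
  have /eqP := e_mu _ _ uw euw; rewrite mu0 cards_eq0 => /eqP/setP/(_ v).
  by rewrite !inE uv e_sym vw.
by move=> u v /= ->; rewrite orbT.
Qed.

(** * Equitable colourings *)

Definition colour_class (T I : finType) (p : T -> I) (i : I) : {set T} :=
  [set y | p y == i].

(** Colours stand for the vertices of a complete quotient: a vertex has no
    neighbour of its own colour and exactly l of every other colour. The boolean
    factor puts both cases into one formula, which sums well. *)
Definition equitable_colouring (T I : finType) (e : rel T) (p : T -> I)
    (b l : nat) : Prop :=
  (forall i, #|colour_class p i| = b) /\
  (forall x i, #|neighbours e x :&: colour_class p i| = l * (i != p x)).

Section Equitable.

Context (T : finType) (e : rel T) (m b l : nat) (p : T -> 'I_m.+1).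
Hypothesis e_sym : symmetric e.
Hypothesis p_eq : equitable_colouring e p b l.

Lemma equitable_adj_neq x y : e x y -> p x != p y.
Proof.
move=> exy; apply/negP => /eqP pxy; have := p_eq.2 x (p y).
rewrite pxy eqxx muln0 => /eqP; rewrite cards_eq0 => /eqP/setP/(_ y).
by rewrite !inE exy eqxx.
Qed.

Lemma equitable_valency x : #|neighbours e x| = l * m.
Proof.
rewrite -sum1_card (partition_big p xpredT) //=.
under eq_bigr => i _.
  rewrite (eq_bigl (mem (neighbours e x :&: colour_class p i))); last first.
    by move=> y; rewrite !inE.
  rewrite sum1_card p_eq.2.
over.
rewrite -big_distrr /= -big_mkcond sum1_card /=.
by congr (_ * _); rewrite cardC1 card_ord.
Qed.

Lemma card_neighbours_setD x i :
  #|neighbours e x :\: colour_class p i| = l * m - l * (i != p x).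
Proof. by rewrite cardsD equitable_valency p_eq.2. Qed.

(** The left side counts the paths x - z - y of length 2 by their end y. Counted
    by the midpoint z, each neighbour z of x whose colour is not i gives l. *)
Lemma equitable_two_paths x i :
  \sum_(y in colour_class p i) #|neighbours e x :&: neighbours e y| =
  l * (l * m - l * (i != p x)).
Proof.
under eq_bigr do rewrite setIC.
rewrite (sum_neighbours_setI _ _ e_sym).
under eq_bigr do rewrite p_eq.2.
rewrite -big_distrr /= -big_mkcondr sum1_card -card_neighbours_setD.
by congr (_ * _); apply: eq_card => z; rewrite unfold_in !inE [i == _]eq_sym andbC.
Qed.

Lemma card_colouring_dom : #|T| = m.+1 * b.
Proof.
rewrite -sum1_card (partition_big p xpredT) //=.
under eq_bigr => i _.
  rewrite (eq_bigl (mem (colour_class p i))); last by move=> y; rewrite !inE.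
  rewrite sum1_card p_eq.1.
over.
by rewrite sum_nat_const card_ord.
Qed.

(** The isomorphism numbers the vertices of each class by their position in its
    enumeration; it is injective, hence bijective as both sides have (m + 1) b
    vertices. *)
Lemma equitable_multipartite :
  (forall x y, p x != p y -> e x y) ->
  graph_iso e (@complete_multipartite m.+1 b).
Proof.
move=> e_full.
have idx_lt x : index x (enum (colour_class p (p x))) < b.
  by rewrite -(p_eq.1 (p x)) cardE index_mem mem_enum inE.
pose f x := (p x, Ordinal (idx_lt x)).
exists f => [|x y]; last first.
  by apply/idP/idP => [/e_full|/equitable_adj_neq].
apply: inj_card_bij => [x y []|]; last first.
  by rewrite card_prod !card_ord card_colouring_dom.
move=> pxy; rewrite pxy => idx_xy.
have mem_class z : p z = p y -> z \in enum (colour_class p (p y)).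
  by move=> pz; rewrite mem_enum inE pz.
by rewrite -(nth_index x (mem_class x pxy)) idx_xy nth_index // mem_class.
Qed.

Section StronglyRegular.

Context (n k lambda mu : nat).
Hypothesis e_srg : strongly_regular e n k lambda mu.

(** A class is independent, so every y <> x of the colour of x is joined to x by
    mu paths; y = x contributes its valency l m. *)
Lemma two_paths_same_class (x : T) : l * m + (b - 1) * mu = l * (l * m).
Proof.
have [_ _ _ e_mu _] := e_srg.
have := equitable_two_paths x (p x); rewrite eqxx muln0 subn0 => <-.
rewrite (big_setD1 x) ?inE //= setIid equitable_valency; congr (_ + _).
have <- : #|colour_class p (p x) :\ x| = b - 1.
  by rewrite -(p_eq.1 (p x)) (cardsD1 x (colour_class _ _)) inE eqxx add1n subn1.
rewrite -sum_nat_const; apply: eq_bigr => y.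
rewrite !inE => /andP[yx /eqP pyx]; rewrite e_mu 1?eq_sym //.
by apply/negP => /equitable_adj_neq; rewrite pyx eqxx.
Qed.

(** Of the b vertices of another class, l are adjacent to x and are joined to it by
    lambda paths; the other b - l are joined to it by mu paths. *)
Lemma two_paths_other_class x i :
  i != p x -> l * lambda + (b - l) * mu = l * (l * m - l).
Proof.
have [_ _ e_lambda e_mu _] := e_srg => ix.
have := equitable_two_paths x i; rewrite ix muln1 => <-.
have deg : #|neighbours e x :&: colour_class p i| = l by rewrite p_eq.2 ix muln1.
rewrite (bigID (mem (neighbours e x))) /=; congr (_ + _).
  rewrite -{1}deg -sum_nat_const; apply: congr_big => // y; rewrite !inE 1?andbC //.
  by case/andP=> _ /e_lambda.
have <- : #|colour_class p i :\: neighbours e x| = b - l.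
  by rewrite cardsD p_eq.1 setIC deg.
rewrite -sum_nat_const; apply: congr_big => // y; rewrite !inE 1?andbC //.
case/andP=> [/eqP py exy]; rewrite e_mu //; apply: contra_neq ix => ->.
by rewrite py.
Qed.

(** A common neighbour of x and y does not have the colour of y, so it is among
    the l m - l neighbours of x of another colour. *)
Lemma equitable_mu_le x y :
  p x != p y -> ~~ e x y -> mu <= l * m - l.
Proof.
have [_ _ _ e_mu _] := e_srg => pxy exy.
have xy : x != y by apply: contra_neq pxy => ->.
rewrite -(e_mu x y xy exy).
have := card_neighbours_setD x (p y); rewrite eq_sym pxy muln1 => <-.
apply: subset_leq_card; apply/subsetP => z; rewrite !inE => /andP[-> yz].
by rewrite andbT eq_sym equitable_adj_neq.
Qed.

End StronglyRegular.

End Equitable.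

(** * Orbits of a normal subgroup of automorphisms *)

Section Orbits.

Context (T : finType) (e : rel T) (G N : {group {perm T}}).
Hypothesis G_aut : G \subset graph_aut e.
Hypothesis N_normal : (N <| G)%g.

Local Notation block x := (orbit 'P N x).

Lemma graph_autE g x y : g \in graph_aut e -> e (g x) (g y) = e x y.
Proof. by rewrite inE => /'forall_'forall_eqP. Qed.

Lemma neighbours_aut g x :
  g \in graph_aut e -> neighbours e (g x) = g @: neighbours e x.
Proof.
move=> g_aut; apply/setP=> y; rewrite -[y](permKV g).
rewrite mem_imset; last exact: perm_inj.
by rewrite !inE graph_autE.
Qed.

(** Normality of N: elements of G map orbits of N to orbits of N. *)
Lemma block_perm g x : g \in G -> block (g x) = g @: block x.
Proof.
move=> gG; apply/setP=> y; rewrite -[y](permKV g).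
rewrite mem_imset; last exact: perm_inj.
have /normsP/(_ g gG) N_g := normal_norm N_normal.
by have := orbit_conjsg 'P N g x (g^-1 y)%g; rewrite N_g /= !apermE.
Qed.

Definition block_deg x y := #|neighbours e x :&: block y|.

Lemma block_deg_perm g x y : g \in G -> block_deg (g x) (g y) = block_deg x y.
Proof.
move=> gG; have g_aut := subsetP G_aut g gG.
rewrite /block_deg neighbours_aut // block_perm // -imsetI; last first.
  by move=> u v _ _; apply: perm_inj.
by rewrite card_imset //; apply: perm_inj.
Qed.

(** The orbit of y is all that matters about y, and N moves x to x' while fixing
    every orbit. *)
Lemma block_deg_block x x' y y' :
  x' \in block x -> y' \in block y -> block_deg x' y' = block_deg x y.
Proof.
move=> /orbitP[h hN <-] /orbit_eqP yy'; rewrite /= apermE.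
have hG := subsetP (normal_sub N_normal) h hN.
rewrite -(block_deg_perm x y hG) /block_deg yy'.
by have /orbit_eqP := mem_orbit 'P y hN; rewrite /= apermE => ->.
Qed.

Hypothesis e_sym : symmetric e.
Hypothesis G_vtrans : vertex_transitive G.

Lemma card_block x y : #|block x| = #|block y|.
Proof.
have [g gG ->] := atransP2 G_vtrans (in_setT y) (in_setT x).
by rewrite /= apermE block_perm // card_imset //; apply: perm_inj.
Qed.

(** The edges between two orbits are [#|block x| * block_deg x y] in number, and
    the orbits have equal sizes. *)
Lemma block_degC x y : block_deg x y = block_deg y x.
Proof.
have := sum_neighbours_setI (block x) (block y) e_sym.
have deg u v : \sum_(w in block u) #|neighbours e w :&: block v| =
    #|block u| * block_deg u v.
  rewrite -sum_nat_const; apply: eq_bigr => w wu.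
  exact: block_deg_block wu (orbit_refl _ _ v).
rewrite !deg (card_block x y) => /eqP; rewrite eqn_pmul2l; first by move/eqP.
by apply/card_gt0P; exists y; apply: orbit_refl.
Qed.

Hypothesis G_etrans : edge_transitive e G.

(** Edges are undirected, so g may exchange the ends; this is why [block_degC] is
    needed below. *)
Lemma edge_transitive_pair x y x' y' : e x y -> e x' y' ->
  exists2 g, g \in G & (g x, g y) = (x', y') \/ (g x, g y) = (y', x').
Proof.
move=> exy exy'.
have mem_edge u v : e u v -> [set u; v] \in edges e.
  by move=> euv; apply/imsetP; exists (u, v); rewrite ?inE.
have ntriv : edges e != set0 by apply/set0Pn; exists [set x; y]; apply: mem_edge.
have [g gG] := atransP2 (G_etrans ntriv) (mem_edge _ _ exy) (mem_edge _ _ exy').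
rewrite /= setactE imsetU !imset_set1 /= !apermE => eq_edge.
exists g => //.
have /set2P gx : g x \in [set x'; y'] by rewrite eq_edge set21.
have /set2P gy : g y \in [set x'; y'] by rewrite eq_edge set22.
have /set2P x'E : x' \in [set g x; g y] by rewrite -eq_edge set21.
have /set2P y'E : y' \in [set g x; g y] by rewrite -eq_edge set22.
case: gx gy x'E y'E => -> [] -> x'E y'E; [left| left| right| left] => //.
  by case: y'E => ->.
by case: x'E => ->.
Qed.

Lemma block_deg_edge x y x' y' :
  e x y -> e x' y' -> block_deg x y = block_deg x' y'.
Proof.
move=> exy exy'; have [g gG] := edge_transitive_pair exy exy'.
by rewrite -(block_deg_perm x y gG) => -[] [-> ->] //; rewrite block_degC.
Qed.

(** If one edge lay in an orbit, then so would all, by edge-transitivity; by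
    connectedness there would be a single orbit. *)
Lemma block_independent : connected_graph e -> ~ vertex_transitive N ->
  forall x y, e x y -> y \notin block x.
Proof.
move=> e_conn N_intrans x y exy; apply/negP => yx; apply: N_intrans.
apply/imsetP; exists x => //; apply/setP=> z; rewrite inE orbit_sym; apply/esym.
apply: (@connected_rel_total T e [rel u v | u \in block v]) => //=.
- exact: orbit_refl.
- by move=> v u w /=; apply: orbit_trans.
move=> u v /= euv; have [g gG] := edge_transitive_pair exy euv.
have gyx : g y \in block (g x) by rewrite block_perm // imset_f.
by case=> [] [<- <-] //; rewrite orbit_sym.
Qed.

(** The colour of a vertex is the image of its orbit under the isomorphism from
    the quotient to the complete graph on 'I_m.+1. *)
Lemma orbit_colouring m :
  graph_iso (quotient_graph e (N := N)) (@complete_graph m.+1) ->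
  exists2 p : T -> 'I_m.+1, forall y, colour_class p (p y) = block y
    & (forall i, exists y, p y = i) /\
      forall x y, p x != p y -> block_adj e (block x) (block y).
Proof.
move=> [f f_bij f_iso].
have orbN x : block x \in orbits N by apply: imset_f.
pose B x : {X : {set T} | X \in orbits N} := Sub (block x) (orbN x).
have B_inj x y : (B x == B y) = (x \in block y).
  by rewrite -val_eqE /= orbit_eq_mem.
exists (f \o B) => [y|].
  by apply/setP => x; rewrite inE /= (inj_eq (bij_inj f_bij)) B_inj.
split=> [i|x y]; last by rewrite -[_ != _]/(complete_graph _ _) f_iso.
have [g fK gK] := f_bij.
have /imsetP[y _ gE] := valP (g i); exists y.
by rewrite -[RHS]gK /=; congr (f _); apply: val_inj.
Qed.

Lemma block_adj_edge x y : block_adj e (block x) (block y) ->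
  exists x' y', [/\ e x' y', x' \in block x & y' \in block y].
Proof.
case/andP=> _ /existsP[x' /andP[x'x /existsP[y' /andP[y'y exy]]]].
by exists x', y'.
Qed.

Lemma block_deg_adj x y x' y' : e x' y' -> 
  block_adj e (block x) (block y) -> block_deg x y = block_deg x' y'.
Proof.
move=> exy /block_adj_edge[u [v [euv ux vy]]].
by rewrite -(block_deg_block ux vy); apply: block_deg_edge.
Qed.

End Orbits.

(** * The parameters *)

Local Open Scope ring_scope.

Theorem proposition3p3 (T : finType) (e : rel T) (n k lambda mu : nat)
    (G N : {group {perm T}}) (m : nat)
    (e_srg : ve_srg e n k lambda mu)
    (e_connected : connected_graph e)
    (G_aut : G \subset graph_aut e)
    (G_vtrans : vertex_transitive G)
    (G_etrans : edge_transitive e G)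
    (N_neq1 : (N :!=: 1)%g)
    (N_normal : (N <| G)%g)
    (N_intrans : ~ vertex_transitive N)
    (m_ge1 : (1 <= m)%N)
    (quot_complete : graph_iso (quotient_graph e (N := N))
                               (@complete_graph m.+1)) :
  exists b l : nat,
    [/\ forall x : T, #|orbit 'P N x| = b,
        k = (l * m)%N
      & forall x y : T, block_adj e (orbit 'P N x) (orbit 'P N y) ->
          #|neighbours e x :&: orbit 'P N y| = l] /\
    [/\ (b%:Z - 1) * mu%:Z = l%:Z * m%:Z * (l%:Z - 1) /\ (2 <= l)%N,
        (b%:Z - l%:Z) * mu%:Z = l%:Z * (l%:Z * m%:Z - l%:Z - lambda%:Z),
        mu%:Z * (l%:Z - 1) = l%:Z * (l%:Z + lambda%:Z - m%:Z),
        (l %| mu)%N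
      & ~ graph_iso e (@complete_multipartite m.+1 b) ->
          mu%:Z <= (m%:Z - 1) * l%:Z].
Proof.
have [e_sr _ _] := e_srg.
have [[e_sym _] [_ e_val] _ _ _] := e_sr.
have [p p_block [p_surj p_adj]] := orbit_colouring quot_complete.
have [x0 px0] := p_surj ord0.
have [y0 py0] := p_surj ord_max.
have p_neq : p x0 != p y0 by rewrite px0 py0 -val_eqE /= eq_sym -lt0n.
have [u [v [euv _ _]]] := block_adj_edge (p_adj _ _ p_neq).
pose b := #|orbit 'P N x0|; pose l := block_deg e N u v.
have b_card x : #|orbit 'P N x| = b by apply: (card_block N_normal G_vtrans).
have l_adj x y :
    block_adj e (orbit 'P N x) (orbit 'P N y) -> block_deg e N x y = l.
  exact: (block_deg_adj G_aut N_normal e_sym G_vtrans G_etrans euv).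
have p_eq : equitable_colouring e p b l.
  (* Every colour is that of some vertex y, and its class is the orbit of y. *)
  split=> [i|x i]; have [y <-] := p_surj i; rewrite p_block //.
  case: (eqVneq (p y) (p x)) => [pyx|pyx]; last first.
    by rewrite muln1; apply: l_adj; apply: p_adj; rewrite eq_sym.
  rewrite muln0; apply/eqP; rewrite cards_eq0; apply/eqP/setP=> z.
  rewrite !inE -p_block pyx p_block; apply/negP => /andP[exz].
  apply/negP.
  exact: (block_independent N_normal G_etrans e_connected N_intrans exz).
have l_gt0 : (0 < l)%N.
  by apply/card_gt0P; exists v; rewrite !inE euv orbit_refl.
have l_le_b : (l <= b)%N.
  by rewrite -(b_card v); apply: subset_leq_card; apply: subsetIr.
(* A nontrivial element of N moves some x within its orbit. *)
have b_gt1 : (1 < b)%N.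
  have /trivgPn[h hN h_neq1] := N_neq1.
  have /existsP[x hx] : [exists x, h x != x].
    apply: contraNT h_neq1; rewrite negb_exists => /forallP h1.
    by apply/eqP/permP=> x; rewrite perm1; apply/eqP; have := h1 x; case: eqP.
  rewrite -(b_card x) (cardsD1 x) orbit_refl add1n ltnS.
  by apply/card_gt0P; exists (h x); rewrite !inE hx -apermE mem_orbit.
have eq1 := two_paths_same_class e_sym p_eq e_sr x0.
have eq2 : (l * lambda + (b - l) * mu = l * (l * m - l))%N.
  by apply: (two_paths_other_class e_sym p_eq e_sr (x := x0) (i := p y0));
    rewrite eq_sym.
have mu_pos : (0 < mu)%N.
  apply: (mu_gt0 e_sr e_connected).
  have := b_gt1; rewrite -(b_card x0) => /card_gt1P[x [y [xx0 yx0 xy]]].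
  exists x, y; split=> //; apply/negP => /(equitable_adj_neq p_eq).
  by move: xx0 yx0; rewrite -p_block !inE => /eqP-> /eqP->; rewrite eqxx.
have E1 : (b%:Z - 1) * mu%:Z = l%:Z * m%:Z * (l%:Z - 1).
  have : l%:Z * m%:Z + (b%:Z - 1) * mu%:Z = l%:Z * (l%:Z * m%:Z).
    by rewrite -[RHS]PoszM -eq1 PoszD !PoszM -subzn // ltnW.
  by move/(canRL (addKr _)) => ->; ring.
have E2 : (b%:Z - l%:Z) * mu%:Z = l%:Z * (l%:Z * m%:Z - l%:Z - lambda%:Z).
  have : l%:Z * lambda%:Z + (b%:Z - l%:Z) * mu%:Z = l%:Z * (l%:Z * m%:Z - l%:Z).
    have l_le_lm : (l <= l * m)%N by rewrite leq_pmulr.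
    by rewrite subzn // -!PoszM subzn // -!PoszM -eq2 PoszD.
  by move/(canRL (addKr _)) => ->; ring.
have E3 : mu%:Z * (l%:Z - 1) = l%:Z * (l%:Z + lambda%:Z - m%:Z).
  (* (b - 1) - (b - l) = l - 1: subtract the two counts. *)
  have -> : mu%:Z * (l%:Z - 1) =
    (b%:Z - 1) * mu%:Z - (b%:Z - l%:Z) * mu%:Z by ring.
  by rewrite E1 E2; ring.
exists b, l; split; split => //.
- by rewrite -(e_val x0); apply: equitable_valency p_eq x0.
(* For l = 1 the count in the own class gives (b - 1) mu = 0. *)
- split=> //; rewrite ltn_neqAle l_gt0 andbT; apply/eqP => l1.
  by move: E1; rewrite -l1 subrr mulr0; nia.
- have -> : (l %| mu)%N = (l%:Z %| mu%:Z)%Z by [].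
  (* mu = l mu - (l - 1) mu, and E3 makes (l - 1) mu a multiple of l. *)
  apply/dvdzP; exists (mu%:Z - (l%:Z + lambda%:Z - m%:Z)).
  by rewrite mulrBl [X in _ - X]mulrC -E3; ring.
move=> not_multi.
suff [x [y [pxy exy]]] : exists x y, p x != p y /\ ~~ e x y.
  have -> : (m%:Z - 1) * l%:Z = ((l * m)%N - l)%N.
    by rewrite -subzn ?leq_pmulr // PoszM; ring.
  by rewrite lez_nat; exact: (equitable_mu_le p_eq e_sr pxy exy).
have [/existsP[x /existsP[y /andP[pxy exy]]]|no_pair] :=
  boolP [exists x, exists y, (p x != p y) && ~~ e x y]; first by exists x, y.
case: not_multi; apply: (equitable_multipartite p_eq) => x y pxy.
apply: contraNT no_pair => exy.
by apply/existsP; exists x; apply/existsP; exists y; rewrite pxy.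
Qed.
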